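(* For every constant $c\in(0,2/15]$ there is a constant $C>0$ depending only on $c$ such that the following holds. Let $f:\mathbb{R}^n\times\mathbb{R}^p\to\mathbb{R}$ be continuously differentiable with $L$-Lipschitz gradient, $\mu_x$-strongly convex in $x$ and $\mu_y$-strongly concave in $y$ (in the precise sense given in the context), with $L\ge\mu_x\ge\mu_y>0$; let $(x^\star,y^\star)$ be its unique saddle point, and let $\kappa_x=L/\mu_x$, $\kappa_y=L/\mu_y$. Let the parameters $h,\rho,\alpha$ satisfy $$\frac{c}{L}\le h\le \frac{2}{15L},\qquad \rho=\frac{h\mu_x}{8},\qquad \frac{4}{4+h\sqrt{\mu_x\mu_y}}\le \alpha\le \frac{8}{8+h\sqrt{\mu_x\mu_y}},$$ and let $(x_t,y_t,v_t)_{t\ge0}$ be generated by the PCE-DM iteration (defined in the context) from an arbitrary initial point $(x_0,y_0)$ with $v_0=0$. Then for every $0<\varepsilon<1$ and every integer $$T\ge C\sqrt{\kappa_x\kappa_y}\,\log\frac{2\kappa_x\kappa_y}{\varepsilon}$$ one has $D_T\le\varepsilon D_0$, where $D_t:=\lVert x_t-x^\star\rVert^2+\lVert y_t-y^\star\rVert^2$. Consequently, since each iteration uses a constant number of new full-gradient evaluations, PCE-DM obtains an iterate with $D_T\le\varepsilon D_0$ using $\mathcal{O}\bigl(\sqrt{\kappa_x\kappa_y}\,\log(2\kappa_x\kappa_y/\varepsilon)\bigr)$ full-gradient evaluations, with the implied constant depending only on $c$.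
   Context: Norms and inner products are Euclidean; $\log$ is the natural logarithm. Assumptions on $f$: (i) $\lVert\nabla f(x',y')-\nabla f(x,y)\rVert\le L\lVert(x'-x,y'-y)\rVert$ for all $(x,y),(x',y')\in\mathbb{R}^n\times\mathbb{R}^p$, where $\nabla f=(\nabla_x f,\nabla_y f)$ is the full gradient; (ii) for all $x,x'\in\mathbb{R}^n$ and $y,y'\in\mathbb{R}^p$, $$f(x',y)\ge f(x,y)+\langle\nabla_x f(x,y),x'-x\rangle+\tfrac{\mu_x}{2}\lVert x'-x\rVert^2,$$ $$f(x,y')\le f(x,y)+\langle\nabla_y f(x,y),y'-y\rangle-\tfrac{\mu_y}{2}\lVert y'-y\rVert^2.$$ Under these assumptions $f$ has a unique saddle point $(x^\star,y^\star)$ (for $\min_x\max_y f$), and $\nabla f(x^\star,y^\star)=0$. PCE-DM iteration with parameters $h,\alpha,\rho$: given $(x_0,y_0)$ and $v_0=0$, for $t=0,1,2,\dots$ set $$\widetilde x_t=x_t-h\nabla_x f(x_t,y_t),\qquad \widetilde y_t=y_t+h\bigl(\nabla_y f(x_t,y_t)+v_t\bigr),$$ $$\widetilde v_t=\alpha v_t+\rho\nabla_y f(\widetilde x_t,\widetilde y_t),$$ $$x_{t+1}=x_t-h\nabla_x f(\widetilde x_t,\widetilde y_t),\qquad y_{t+1}=y_t+h\bigl(\nabla_y f(\widetilde x_t,\widetilde y_t)+\widetilde v_t\bigr),$$ $$v_{t+1}=\alpha v_t+\rho\nabla_y f(x_{t+1},y_{t+1}).$$ A full-gradient evaluation (query)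 at a point returns $\nabla f$ at that point. After one initial query at $(x_0,y_0)$, each iteration makes two new queries, at $(\widetilde x_t,\widetilde y_t)$ and at $(x_{t+1},y_{t+1})$ (the latter being reused in the next iteration), so $T$ iterations use $1+2T$ queries. *)

(* Defs.v *)
From HB Require Import structures.
From mathcomp Require Import all_boot all_order all_algebra.
From mathcomp Require Import all_classical all_reals all_analysis.

Set Implicit Arguments.
Unset Strict Implicit.
Unset Printing Implicit Defensive.

Import Order.TTheory GRing.Theory Num.Theory.
Import numFieldNormedType.Exports.
Local Open Scope ring_scope.

(* The library norm on 'rV[R]_n and on products is the sup norm, so the
   Euclidean structure is introduced here; both norms induce the same topology,
   hence the same notions of differentiability and continuity. *)
Definition dot (R : realType) (n : nat) (u v : 'rV[R]_n) : R :=
  \sum_(i < n) u 0 i * v 0 i.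

Definition enorm (R : realType) (n : nat) (u : 'rV[R]_n) : R :=
  Num.sqrt (dot u u).

Definition enorm_pair (R : realType) (n p : nat) (w : 'rV[R]_n * 'rV[R]_p) : R :=
  Num.sqrt (enorm w.1 ^+ 2 + enorm w.2 ^+ 2).

Section MinMax.
Variables (R : realType) (n p : nat).
Implicit Types (f : 'rV[R]_n * 'rV[R]_p -> R) (z : 'rV[R]_n * 'rV[R]_p).

Definition gradx f z : 'rV[R]_n :=
  \row_(i < n) 'D_(delta_mx 0 i) (fun x : 'rV[R]_n => f (x, z.2)) z.1.

Definition grady f z : 'rV[R]_p :=
  \row_(j < p) 'D_(delta_mx 0 j) (fun y : 'rV[R]_p => f (z.1, y)) z.2.

Definition grad f z : 'rV[R]_n * 'rV[R]_p := (gradx f z, grady f z).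

Definition continuously_differentiable f : Prop :=
  (forall z, differentiable f z) /\ continuous (grad f).

Definition lipschitz_grad f (L : R) : Prop :=
  forall z z', enorm_pair (grad f z' - grad f z) <= L * enorm_pair (z' - z).

Definition strongly_convex_x f (mux : R) : Prop :=
  forall (x x' : 'rV[R]_n) (y : 'rV[R]_p),
    f (x, y) + dot (gradx f (x, y)) (x' - x) + mux / 2 * enorm (x' - x) ^+ 2
      <= f (x', y).

Definition strongly_concave_y f (muy : R) : Prop :=
  forall (x : 'rV[R]_n) (y y' : 'rV[R]_p),
    f (x, y') <=
      f (x, y) + dot (grady f (x, y)) (y' - y) - muy / 2 * enorm (y' - y) ^+ 2.

Definition saddle_point f z : Prop :=
  forall (x : 'rV[R]_n) (y : 'rV[R]_p), f (z.1, y) <= f z /\ f z <= f (x, z.2).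

Record pce_state : Type := PceState {
  pce_x : 'rV[R]_n;
  pce_y : 'rV[R]_p;
  pce_v : 'rV[R]_p
}.

Definition pce_point (s : pce_state) : 'rV[R]_n * 'rV[R]_p :=
  (pce_x s, pce_y s).

Definition pce_predict f (h alpha rho : R) (s : pce_state) : pce_state :=
  let z := pce_point s in
  let zt := (pce_x s - h *: gradx f z,
             pce_y s + h *: (grady f z + pce_v s)) in
  PceState zt.1 zt.2 (alpha *: pce_v s + rho *: grady f zt).

Definition pce_step f (h alpha rho : R) (s : pce_state) : pce_state :=
  let st := pce_predict f h alpha rho s in
  let zt := pce_point st in
  let z1 := (pce_x s - h *: gradx f zt,
             pce_y s + h *: (grady f zt + pce_v st)) in
  PceState z1.1 z1.2 (alpha *: pce_v s + rho *: grady f z1).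

Definition pce_iter f (h alpha rho : R) (z0 : 'rV[R]_n * 'rV[R]_p) (t : nat) :
    pce_state :=
  iter t (pce_step f h alpha rho) (PceState z0.1 z0.2 0).

(* The points at which the full gradient is evaluated during the first T
   iterations, in order.  The gradient at the current iterate is reused by the
   next iteration, so that point is listed only once. *)
Definition pce_queries f (h alpha rho : R) (z0 : 'rV[R]_n * 'rV[R]_p)
    (T : nat) : seq ('rV[R]_n * 'rV[R]_p) :=
  z0 :: flatten [seq [:: pce_point (pce_predict f h alpha rho
                                      (pce_iter f h alpha rho z0 t));
                         pce_point (pce_iter f h alpha rho z0 t.+1)]
                | t <- iota 0 T].

Definition sqdist z z' : R :=
  enorm (z.1 - z'.1) ^+ 2 + enorm (z.2 - z'.2) ^+ 2.

End MinMax.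

(* Main.v *)
Require Import Defs.
From HB Require Import structures.
From mathcomp Require Import all_boot all_order all_algebra.
From mathcomp Require Import all_classical all_reals all_analysis.
From mathcomp Require Import ring lra.

Set Implicit Arguments.
Unset Strict Implicit.
Unset Printing Implicit Defensive.

Import Order.TTheory GRing.Theory Num.Theory.
Import numFieldNormedType.Exports.
Local Open Scope ring_scope.

(* In the continuous-time limit x' = - gx, y' = gy + v, v' = m gy - d v with
   m = mux / 8 and d of order sqrt (mux muy), the function
     |gx|^2 / 2 + |gy + v|^2 / 2 + 2 |v|^2 - 5 m (f - f* )
       + d <v, y - y*> + d^2 |y - y*|^2 / 2
   decreases at a rate of order d: the first two terms dissipate because the
   saddle operator is monotone, the weight 5 m cancels the product <gy, v>, and
   - 5 m (f - f* ) is dominated by |gx|^2 / 2 since strong convexity in x gives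
   2 mux (f - f* ) <= |gx|^2.  The cross term <v, y - y*> turns the concavity
   inequality <gy, y - y*> <= f - f* into decrease at rate d, not muy.
   For the iteration itself, v' - v = - D v' + M gy' with D = 1 / alpha - 1 is
   an implicit Euler step, and all discretization errors are absorbed by the
   extragradient term |p - p~|^2 / 2, where p = (gx, - (gy + v)) and
   p~ is the same vector at the predicted point. *)

(** * Euclidean inner product *)

Lemma dotC (R : realType) n (u v : 'rV[R]_n) : dot u v = dot v u.
Proof. by apply: eq_bigr => i _; rewrite mulrC. Qed.

Lemma dotDl (R : realType) n (u v w : 'rV[R]_n) :
  dot (u + v) w = dot u w + dot v w.
Proof. by rewrite -big_split; apply: eq_bigr => i _; rewrite mxE mulrDl. Qed.

Lemma dotZl (R : realType) n a (u w : 'rV[R]_n) : dot (a *: u) w = a * dot u w.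
Proof. by rewrite /dot mulr_sumr; apply: eq_bigr => i _; rewrite mxE mulrA. Qed.

Lemma dotDr (R : realType) n (u v w : 'rV[R]_n) :
  dot w (u + v) = dot w u + dot w v.
Proof. by rewrite dotC dotDl !(dotC w). Qed.

Lemma dotZr (R : realType) n a (u w : 'rV[R]_n) : dot w (a *: u) = a * dot w u.
Proof. by rewrite dotC dotZl dotC. Qed.

Lemma dotNl (R : realType) n (u w : 'rV[R]_n) : dot (- u) w = - dot u w.
Proof. by rewrite -scaleN1r dotZl mulN1r. Qed.

Lemma dotNr (R : realType) n (u w : 'rV[R]_n) : dot w (- u) = - dot w u.
Proof. by rewrite dotC dotNl dotC. Qed.

Lemma dot0 (R : realType) n : dot (0 : 'rV[R]_n) 0 = 0.
Proof. by rewrite -[X in dot X _](scale0r 0) dotZl mul0r. Qed.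

Definition dotE := (dotDl, dotDr, dotNl, dotNr, dotZl, dotZr).

Lemma dot_ge0 (R : realType) n (u : 'rV[R]_n) : 0 <= dot u u.
Proof. by apply: sumr_ge0 => i _; rewrite -expr2 sqr_ge0. Qed.

Lemma dot_eq0 (R : realType) n (u : 'rV[R]_n) : dot u u <= 0 -> u = 0.
Proof.
move=> u0; apply/rowP => i; rewrite mxE.
have /eqP : dot u u = 0 by apply/eqP; rewrite eq_le u0 dot_ge0.
rewrite psumr_eq0 => [/allP /(_ i)|j _]; last by rewrite -expr2 sqr_ge0.
by rewrite mem_index_enum => /(_ isT) /=; rewrite mulf_eq0 orbb => /eqP.
Qed.

(** Expands |a u - w|^2 >= 0. Products of either sign are bounded through it, by the choice of the
    sign of [a]. *)
Lemma dot_young (R : realType) n (a : R) (u w : 'rV[R]_n) :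
  2 * a * dot u w <= a ^+ 2 * dot u u + dot w w.
Proof. by have := dot_ge0 (a *: u - w); rewrite !dotE (dotC w u); lra. Qed.

Lemma enorm_sqr (R : realType) n (u : 'rV[R]_n) : enorm u ^+ 2 = dot u u.
Proof. by rewrite sqr_sqrtr// dot_ge0. Qed.

(** * One-step decrease of the Lyapunov function, in vector algebra *)

(* The Lyapunov function rescaled by the step size h: P = h mux, Q = h muy,
   Y = (y - y* ) / h and phi = (f - f* ) / h, so that h disappears. *)
Definition potential (R : realType) n p (M D : R) (gx : 'rV[R]_n)
    (gy v Y : 'rV[R]_p) (phi : R) : R :=
  1 / 2 * dot gx gx + 1 / 2 * dot (gy + v) (gy + v) + 2 * dot v v
    - 5 * M * phi + D * dot v Y + D ^+ 2 / 2 * dot Y Y.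

(** Suffix 1 marks the predicted point and a prime the next iterate. [M] is rho / alpha, which
    appears when the update of v is solved for the old v. [t] is chosen so that the [phi'] created
    by the growth factor cancels the [phi'] coming from concavity in y. *)
Lemma potential_step (R : realType) n p (P Q M D rho t : R)
  (gx gx1 gx' : 'rV[R]_n) (gy gy1 gy' v v1 v' Y Y' : 'rV[R]_p) (phi phi' : R) :
  0 < Q -> Q <= P -> P <= 2 / 15 -> 0 < D -> D ^+ 2 <= P * Q / 16 ->
  rho = P / 8 -> M = rho * (1 + D) -> t = D * (M + D) / (5 * M) ->
  v = (1 + D) *: v' - M *: gy' ->
  v1 = v' + rho *: (gy1 - gy') ->
  Y' = Y + (gy1 + v1) ->
  P * dot gx1 gx1 + Q * dot (gy1 + v1) (gy1 + v1)
    <= - dot (gx' - gx) gx1 - dot (gy' - gy) (gy1 + v1) ->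
  dot (gx' - gx1) (gx' - gx1) + dot (gy' - gy1) (gy' - gy1)
    <= 4 / 225 * (dot (gx1 - gx) (gx1 - gx)
                  + dot ((gy1 + v1) - (gy + v)) ((gy1 + v1) - (gy + v))) ->
  dot gy' Y' <= phi' - Q / 2 * dot Y' Y' ->
  dot gy' (gy1 + v1) - dot gx gx1 <= phi' - phi ->
  (1 + t) * potential M D gx' gy' v' Y' phi' <= potential M D gx gy v Y phi.
Proof.
move=> Q0 QP P15 D0 D2 rhoE ME tE.
have P0 : 0 < P by lra.
(* Since Q <= P, D^2 <= P Q / 16 gives D <= P / 4, hence D <= 2 M and M + D <= 3 M; this is the
   source of t <= 3 D / 5. *)
have D30 : D <= P / 4 by nra.
have M1 : P / 8 <= M by rewrite ME rhoE; nra.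
have M2 : M <= P * 31 / 240 by rewrite ME rhoE; nra.
have M0 : 0 < M by lra.
have D2' : D ^+ 2 <= M * Q / 2 by nra.
have tM : t * (5 * M) = D * (M + D) by rewrite tE divfK// gt_eqF; lra.
have t0 : 0 < t by rewrite tE; apply: divr_gt0; nra.
have t1 : t <= 3 / 5 * D by rewrite tE ler_pdivrMr; nra.
have D1 : D <= 1 / 30 by lra.
have M50 : M <= 1 / 50 by lra.
have t50 : t <= 1 / 50 by lra.
have tP : t <= 3 / 20 * P by lra.
have tM' : t <= 6 / 5 * M by lra.
have MD0 : 0 <= D * M by nra.
have DM30 : D * M <= M / 30 by nra.
have DM50 : D * M <= D / 50 by nra.
have DD30 : D ^+ 2 <= D / 30 by nra.
have M0' := ltW M0; have D0' := ltW D0; have t0' := ltW t0.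
have QDM0 : 0 <= D * M + D ^+ 2 by nra.
have rho1 : rho <= 1 / 60 by lra.
have rho2 : (1 + rho) * (1 + rho) <= 26 / 25 by nra.
(* New coordinates: [dx] and [dy] form the extragradient difference, while [ex] and [e] are
   corrector errors, whose squares [lip] bounds by a fiftieth of it. *)
pose e := (1 + rho) *: (gy1 - gy'); pose dy := gy + v - (gy1 + v1).
pose dx := gx - gx1; pose ex := gx1 - gx'.
move=> vE v1E Y'E mono lip concY dphi.
have q1E : gy1 + v1 = gy' + v' + e.
  by rewrite v1E; apply/rowP => i; rewrite !mxE; ring.
have {lip} lip : dot ex ex + dot e e <= (dot dx dx + dot dy dy) / 50.
  rewrite -[gx' - gx1]opprB -[gy' - gy1]opprB -[gx1 - gx]opprB in lip.
  rewrite -[gy1 + v1 - _]opprB -/dy -/dx -/ex !(dotNl, dotNr) !opprK in lip.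
  rewrite /e !(dotZl, dotZr).
  have ex0 := dot_ge0 ex; have e0 := dot_ge0 (gy1 - gy').
  by move: rho2 => /(ler_wpM2r e0); clear -lip ex0 e0; lra.
have gyE : gy = gy' + v' + e + dy - v.
  by rewrite -q1E; apply/rowP => i; rewrite !mxE; ring.
have YE : Y = Y' - (gy' + v' + e).
  by rewrite -q1E Y'E; apply/rowP => i; rewrite !mxE; ring.
have gxE : gx = gx1 + dx by apply/rowP => i; rewrite !mxE; ring.
have gx'E : gx' = gx1 - ex by apply/rowP => i; rewrite !mxE; ring.
move: mono concY dphi.
rewrite q1E {}gyE {}YE {}gx'E {}gxE {}vE /potential.
move: e dy dx ex lip {q1E v1E Y'E} => e dy dx ex lip.
rewrite !dotE !(dotC dx) !(dotC ex) !(dotC e) !(dotC dy) !(dotC v') !(dotC Y').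
have kk := dot_ge0 gx1; have xx := dot_ge0 dx; have exx := dot_ge0 ex.
have gg := dot_ge0 gy'; have vv := dot_ge0 v'; have ee := dot_ge0 e.
have qq := dot_ge0 (gy' + v' + e).
rewrite !dotE (dotC e gy') (dotC v' e) (dotC v' gy') in qq.
have ww := dot_ge0 (M *: gy' - D *: v'); rewrite !dotE (dotC v' gy') in ww.
have YY := dot_ge0 Y'; have yy := dot_ge0 dy.
have y1 := dot_young (1 / 2) gx1 dx; rewrite ?(dotC dx) in y1.
have y2 := dot_young (- 1) gx1 ex.
have y3 := dot_young 1 gy' v'.
have y3' := dot_young (- 1) gy' v'.
have y4 := dot_young (- (1 / 2)) gy' e.
have y5 := dot_young 1 e v'.
have y6 := dot_young D Y' v'; rewrite (dotC Y') in y6.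
have y7 := dot_young (D / 2) Y' e; rewrite (dotC Y') in y7.
(* Each inner product becomes a real variable; only scalar inequalities remain. *)
move: (dot gx1 gx1) (dot dx dx) (dot ex ex) (dot gx1 dx) (dot gx1 ex)
  (dot gy' gy') (dot v' v') (dot e e) (dot gy' v') (dot gy' e) (dot e v')
  (dot Y' Y') (dot gy' Y') (dot v' Y') (dot e Y') (dot dy dy) (dot gy' dy)
  (dot dy v') (dot e dy) qq ww lip kk xx exx gg vv ee YY yy y1 y2 y3
  y3' y4 y5 y6 y7 => KK XX EX KX KE GG VV EE GV GE EV YY GY VY EY DY
  GDY DYV EDY qq ww lip kk xx exx gg vv ee Y0 yy y1 y2 y3
  y3' y4 y5 y6 y7.
(* The x-part: the loss from the weight 5 M and the growth of |gx'|^2 / 2 are paid by the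
   monotonicity term [P * KK]. *)
have hx : 5 * M * (KK + KX) + t / 2 * (KK - 2 * KE + EX)
    <= P * KK + XX / 8 + EX / 50.
  have a1 := ler_wpM2l M0' y1.
  have a2 := ler_wpM2l t0' y2.
  have a3 := ler_wpM2r kk M2.
  have a4 := ler_wpM2r xx M50.
  have a5 := ler_wpM2r exx t50.
  have a6 := ler_wpM2r kk tP.
  have a7 : 0 <= P * KK by apply: mulr_ge0 => //; exact: ltW.
  by lra.
have QY0 := mulr_ge0 (ltW Q0) Y0.
(* Terms in [Y'] are paid by the strong concavity term, through D^2 <= M Q / 2. *)
have hY : D ^+ 2 * EY + t * (D * VY + D ^+ 2 / 2 * YY)
    <= (D * M + D ^+ 2) * Q / 2 * YY + EE / 30 + t / 2 * VV.
  have a1 := ler_wpM2l D0' y7.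
  have a2 := ler_wpM2l t0' y6.
  have a3 := ler_wpM2r ee D1.
  have a4 := ler_wpM2r Y0 (ler_wpM2l D0' D2').
  have a5 := ler_wpM2r Y0 (ler_wpM2l t0' D2').
  have a6 : t * (5 * M) * (Q * YY) = D * (M + D) * (Q * YY) by rewrite tM.
  have a7 : 0 <= D * M * (Q * YY) by exact: mulr_ge0.
  have a8 : 0 <= D ^+ 2 * (Q * YY) by exact: mulr_ge0 (sqr_ge0 D) QY0.
  by lra.
(* Terms in [gy'] and [v']. The weight 5 M leaves no [GV] of order M: monotonicity takes 1 M and the
   increment of 2 |v|^2 takes 4 M. *)
have hgv : t / 2 * (GG + 2 * GV + VV) + 2 * t * VV + t / 2 * VV
    - (4 + D) * M * (GG + GE) - D * (M - D) * GV - (4 * D - D ^+ 2) * VV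
    + D ^+ 2 * EV <= EE / 5.
  have a1 := ler_wpM2l t0' y3.
  have a2 := ler_wpM2r gg tM'.
  have a3 := ler_wpM2r vv t1.
  have a4 := ler_wpM2l M0' y4.
  have a5 := ler_wpM2l MD0 y4.
  have a6 := ler_wpM2r gg DM30.
  have a7 := ler_wpM2r vv DM50.
  have a8 := ler_wpM2r vv DD30.
  have a9 := ler_wpM2l (sqr_ge0 D) y5.
  have a10 := ler_wpM2r ee DM30.
  have a11 := ler_wpM2r ee DD30.
  have a12 := ler_wpM2r ee M50.
  have a13 := ler_wpM2r ee D1.
  (* M - D has no fixed sign, so its product with [GV] is split over |gy' + v'|^2 and |gy' - v'|^2
     with nonnegative weights. *)
  have a14 : 0 <= D * (2 * M - D) * (GG + 2 * GV + VV).
    by apply: mulr_ge0; [apply: mulr_ge0|] => //; clear -y3' D30 M1 P0; lra.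
  have a15 : 0 <= D ^+ 2 * (GG - 2 * GV + VV).
    by apply: mulr_ge0; [exact: sqr_ge0|clear -y3; lra].
  have a16 : 0 <= M * GG by exact: mulr_ge0.
  have a18 := mulr_ge0 MD0 gg.
  have a17 : 0 <= D * VV by exact: mulr_ge0.
  by lra.
have {}qq := mulr_ge0 (addr_ge0 (ltW Q0) (divr_ge0 (sqr_ge0 D) (ler0n _ 2))) qq.
move=> mono concY dphi.
have b1 := ler_wpM2l M0' dphi.
have b2 := ler_wpM2l QDM0 concY; clear D2 D2' ME tE.
have b3 : t * (5 * M) * phi' = D * (M + D) * phi' by rewrite tM.
by lra.
Qed.

(** * Gradient inequalities for the saddle function *)

Lemma sqdistE (R : realType) n p (z z' : 'rV[R]_n * 'rV[R]_p) :
  sqdist z z' = dot (z.1 - z'.1) (z.1 - z'.1) + dot (z.2 - z'.2) (z.2 - z'.2).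
Proof. by rewrite /sqdist !enorm_sqr. Qed.

Lemma sqdist_ge0 (R : realType) n p (z z' : 'rV[R]_n * 'rV[R]_p) :
  0 <= sqdist z z'.
Proof. by rewrite sqdistE addr_ge0// dot_ge0. Qed.

Section Gradient.
Variables (R : realType) (n p : nat) (f : 'rV[R]_n * 'rV[R]_p -> R).
Variables (L mux muy : R).
Hypotheses (lipf : lipschitz_grad f L).
Hypotheses (cvxf : strongly_convex_x f mux) (cncf : strongly_concave_y f muy).
Hypotheses (muy0 : 0 < muy) (muxy : muy <= mux) (muxL : mux <= L).

Let mux0 : 0 < mux. Proof. exact: lt_le_trans muxy. Qed.
Let L0 : 0 < L. Proof. exact: lt_le_trans muxL. Qed.

Lemma lipschitz_grad_sqr z z' :
  dot (gradx f z' - gradx f z) (gradx f z' - gradx f z)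
    + dot (grady f z' - grady f z) (grady f z' - grady f z)
  <= L ^+ 2 * sqdist z' z.
Proof.
have := lipf z z'; rewrite /enorm_pair /= !enorm_sqr -sqdistE => H.
rewrite -[X in X <= _]sqr_sqrtr ?addr_ge0 ?dot_ge0//.
rewrite -[X in _ * X]sqr_sqrtr ?sqdist_ge0// -exprMn.
by rewrite lerXn2r// nnegrE ?mulr_ge0 ?sqrtr_ge0// ltW.
Qed.

(** Two convexity and two concavity inequalities around the rectangle with corners z and z' add up,
    and all values of f cancel. *)
Lemma saddle_operator_strongly_monotone z z' :
  mux * dot (z'.1 - z.1) (z'.1 - z.1) + muy * dot (z'.2 - z.2) (z'.2 - z.2)
  <= dot (gradx f z' - gradx f z) (z'.1 - z.1)
     - dot (grady f z' - grady f z) (z'.2 - z.2).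
Proof.
case: z z' => x y [x' y'] /=.
have := cvxf x x' y; have := cvxf x' x y'.
have := cncf x y y'; have := cncf x' y' y.
rewrite !enorm_sqr -[x - x']opprB -[y - y']opprB.
move: (x' - x) (y' - y) => dx dy.
rewrite !dotE; lra.
Qed.

(** A Polyak-Lojasiewicz bound: strong convexity compares z' with (xs, y), where f is at most its
    saddle value. *)
Lemma gap_le_gradx z z' : saddle_point f z ->
  2 * mux * (f z' - f z) <= dot (gradx f z') (gradx f z').
Proof.
case: z z' => xs ys [x y] /(_ xs y) [/= sad _].
have := cvxf x xs y; rewrite enorm_sqr => cvx.
have := dot_young (- mux) (xs - x) (gradx f (x, y)).
rewrite (dotC (xs - x)).
have : mux * (f (x, y) + dot (gradx f (x, y)) (xs - x)
   + mux / 2 * dot (xs - x) (xs - x)) <= mux * f (xs, ys).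
  by rewrite (ler_wpM2l (ltW mux0))// (le_trans cvx sad).
lra.
Qed.

Lemma grady_le_gap z z' : saddle_point f z ->
  dot (grady f z') (z'.2 - z.2) + muy / 2 * dot (z'.2 - z.2) (z'.2 - z.2)
  <= f z' - f z.
Proof.
case: z z' => xs ys [x y] /(_ x ys) [_ /= sad].
have := cncf x y ys; rewrite enorm_sqr -[ys - y]opprB !dotE /=; lra.
Qed.

(** Passing through the corner (x', y) puts the x-gradient at the start and the y-gradient at the
    end, the pairing that [potential_step] asks for. *)
Lemma gap_increment z z' :
  dot (gradx f z) (z'.1 - z.1) + dot (grady f z') (z'.2 - z.2) <= f z' - f z.
Proof.
case: z z' => x y [x' y'] /=.
have := cvxf x x' y; have := cncf x' y' y; rewrite !enorm_sqr.
have : 0 <= mux / 2 * dot (x' - x) (x' - x).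
  by rewrite mulr_ge0 ?dot_ge0// divr_ge0// ltW.
have : 0 <= muy / 2 * dot (y - y') (y - y').
  by rewrite mulr_ge0 ?dot_ge0// divr_ge0// ltW.
rewrite -[y - y']opprB !dotE; lra.
Qed.

(* The optimality inequality is tested along the gradient itself, with a step
   short enough for the Lipschitz bound to preserve half of its norm. *)
Lemma gradx_saddle z : saddle_point f z -> gradx f z = 0.
Proof.
case: z => xs ys sad.
set g := gradx f (xs, ys); pose x := xs - (2 * L)^-1 *: g.
have xE : x - xs = - ((2 * L)^-1 *: g) by rewrite /x addrAC subrr add0r.
have H1 : 0 <= dot (gradx f (x, ys)) (x - xs).
  have := cvxf x xs ys; have [_ /=] := sad x ys; rewrite enorm_sqr.
  have : 0 <= mux / 2 * dot (xs - x) (xs - x).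
    by rewrite mulr_ge0 ?dot_ge0// divr_ge0// ltW.
  rewrite -[xs - x]opprB !dotE; lra.
have H2 := lipschitz_grad_sqr (xs, ys) (x, ys).
have E : L ^+ 2 * dot (x - xs) (x - xs) = dot g g / 4.
  by rewrite xE !dotE; field; rewrite gt_eqF.
rewrite sqdistE /= subrr dot0 addr0 E -/g in H2.
rewrite xE !dotE oppr_ge0 pmulr_rle0 in H1; last by rewrite invr_gt0 mulr_gt0.
have := dot_ge0 (grady f (x, ys) - grady f (xs, ys)).
have := dot_young (- 1) g (gradx f (x, ys) - g).
by move: H1 H2; rewrite !dotE (dotC g) => *; apply: dot_eq0; lra.
Qed.

Lemma grady_saddle z : saddle_point f z -> grady f z = 0.
Proof.
case: z => xs ys sad.
set g := grady f (xs, ys); pose y := ys + (2 * L)^-1 *: g.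
have yE : y - ys = (2 * L)^-1 *: g by rewrite /y addrAC subrr add0r.
have H1 : dot (grady f (xs, y)) (y - ys) <= 0.
  have := cncf xs y ys; have [/= + _] := sad xs y; rewrite enorm_sqr.
  have : 0 <= muy / 2 * dot (ys - y) (ys - y).
    by rewrite mulr_ge0 ?dot_ge0// divr_ge0// ltW.
  rewrite -[ys - y]opprB !dotE; lra.
have H2 := lipschitz_grad_sqr (xs, ys) (xs, y).
have E : L ^+ 2 * dot (y - ys) (y - ys) = dot g g / 4.
  by rewrite yE !dotE; field; rewrite gt_eqF.
rewrite sqdistE /= subrr dot0 add0r E -/g in H2.
rewrite yE !dotE pmulr_rle0 in H1; last by rewrite invr_gt0 mulr_gt0.
have := dot_ge0 (gradx f (xs, y) - gradx f (xs, ys)).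
have := dot_young (- 1) g (grady f (xs, y) - g).
by move: H1 H2; rewrite !dotE (dotC g) => *; apply: dot_eq0; lra.
Qed.

Lemma grad_sqr_le_dist z z' : saddle_point f z ->
  dot (gradx f z') (gradx f z') + dot (grady f z') (grady f z')
  <= L ^+ 2 * sqdist z' z.
Proof.
move=> sad; have := lipschitz_grad_sqr z z'.
by rewrite (gradx_saddle sad) (grady_saddle sad) !subr0.
Qed.

(** Strong monotonicity against the saddle point, where the gradient vanishes, with both moduli
    replaced by the smaller one, [muy]. *)
Lemma dist_le_grad_sqr z z' : saddle_point f z ->
  muy ^+ 2 * sqdist z' z
  <= dot (gradx f z') (gradx f z') + dot (grady f z') (grady f z').
Proof.
move=> sad; have := saddle_operator_strongly_monotone z z'.
rewrite (gradx_saddle sad) (grady_saddle sad) !subr0 sqdistE.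
move: (z'.1 - z.1) (z'.2 - z.2) (gradx f z') (grady f z') => x y gx gy H.
have := dot_young muy x gx; have := dot_young (- muy) y gy.
rewrite (dotC x) (dotC y).
have : muy * (muy * dot x x + muy * dot y y)
    <= muy * (dot gx x - dot gy y).
  rewrite (ler_wpM2l (ltW muy0))//.
  by apply: le_trans H; rewrite lerD2r ler_wpM2r ?dot_ge0.
lra.
Qed.

End Gradient.

(** * Contraction along the iteration *)

Section Descent.
Variables (R : realType) (n p : nat) (f : 'rV[R]_n * 'rV[R]_p -> R).
Variables (L mux muy h alpha D M : R) (zs : 'rV[R]_n * 'rV[R]_p).
Hypotheses (lipf : lipschitz_grad f L).
Hypotheses (cvxf : strongly_convex_x f mux) (cncf : strongly_concave_y f muy).
Hypotheses (muy0 : 0 < muy) (muxy : muy <= mux) (muxL : mux <= L).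
Hypotheses (sad : saddle_point f zs).
Hypotheses (h0 : 0 < h) (hL : h * L <= 2 / 15).

Hypotheses (alpha0 : 0 < alpha) (DE : 1 + D = alpha^-1) (D0 : 0 < D).
Hypothesis ME : M = h * mux / 8 * (1 + D).
Hypothesis D2 : D ^+ 2 <= (h * mux) * (h * muy) / 16.

Let mux0 : 0 < mux. Proof. exact: lt_le_trans muxy. Qed.
Let L0 : 0 < L. Proof. exact: lt_le_trans muxL. Qed.

Definition pce_potential (s : pce_state R n p) : R :=
  potential M D (gradx f (pce_point s)) (grady f (pce_point s)) (pce_v s)
    (h^-1 *: (pce_y s - zs.2)) ((f (pce_point s) - f zs) / h).

Lemma potential_descent z zt z' v v1 v' :
  zt = (z.1 - h *: gradx f z, z.2 + h *: (grady f z + v)) ->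
  v1 = alpha *: v + (h * mux / 8) *: grady f zt ->
  z' = (z.1 - h *: gradx f zt, z.2 + h *: (grady f zt + v1)) ->
  v' = alpha *: v + (h * mux / 8) *: grady f z' ->
  (1 + D * (M + D) / (5 * M)) *
    potential M D (gradx f z') (grady f z') v' (h^-1 *: (z'.2 - zs.2))
      ((f z' - f zs) / h)
  <= potential M D (gradx f z) (grady f z) v (h^-1 *: (z.2 - zs.2))
      ((f z - f zs) / h).
Proof.
have hne : h != 0 by rewrite gt_eqF.
move=> ztE v1E z'E v'E.
have dx : z'.1 - z.1 = - (h *: gradx f zt).
  by rewrite z'E /= addrAC subrr add0r.
have dy : z'.2 - z.2 = h *: (grady f zt + v1).
  by rewrite z'E /= addrAC subrr add0r.
have hmu : h * mux <= 2 / 15 by apply: le_trans hL; rewrite ler_pM2l.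
apply: (@potential_step R n p (h * mux) (h * muy) M D (h * mux / 8) _
  (gradx f z) (gradx f zt) (gradx f z') (grady f z) (grady f zt) (grady f z')
  v v1 v') => //.
- by rewrite mulr_gt0.
- by rewrite ler_pM2l.
- rewrite v'E ME DE scalerDr !scalerA mulVf ?gt_eqF// scale1r.
  by rewrite [alpha^-1 * _]mulrC addrK.
- by rewrite v'E v1E; apply/rowP => i; rewrite !mxE; ring.
- by rewrite z'E /=; apply/rowP => i; rewrite !mxE; field.
- have := saddle_operator_strongly_monotone cvxf cncf z z'; rewrite dx dy => H.
  rewrite -(ler_pM2l h0); move: H.
  move: (gradx f zt) (grady f zt + v1) (gradx f z' - _) (grady f z' - _).
  by move=> a b c d; rewrite !(dotNl, dotNr, dotZl, dotZr); lra.
(* The next and predicted points differ by h times the extragradient difference, so the Lipschitz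
   factor is (h L)^2 <= (2 / 15)^2 = 4 / 225. *)
- have := lipschitz_grad_sqr lipf muy0 muxy muxL zt z'.
  rewrite sqdistE.
  have -> : z'.1 - zt.1 = (- h) *: (gradx f zt - gradx f z).
    by rewrite z'E ztE /=; apply/rowP => i; rewrite !mxE; ring.
  have -> : z'.2 - zt.2 = h *: (grady f zt + v1 - (grady f z + v)).
    by rewrite z'E ztE /=; apply/rowP => i; rewrite !mxE; ring.
  rewrite !dotZl !dotZr.
  have q0 := dot_ge0 (gradx f zt - gradx f z).
  have r0 := dot_ge0 (grady f zt + v1 - (grady f z + v)).
  move=> H; apply: (le_trans H).
  have -> : forall a b, L ^+ 2 * (- h * (- h * a) + h * (h * b))
    = (h * L) ^+ 2 * (a + b) by move=> a b; ring.
  apply: ler_wpM2r; first by rewrite addr_ge0.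
  have -> : 4 / 225 = (2 / 15) ^+ 2 :> R by field.
  by rewrite lerXn2r// nnegrE ?mulr_ge0// ltW.
- have := grady_le_gap cncf z' sad => H.
  rewrite -(ler_pM2l h0); move: H; move: (z'.2 - zs.2) => w.
  rewrite !(dotNl, dotNr, dotZl, dotZr) mulrBr => H.
  have -> : h * (h^-1 * dot (grady f z') w) = dot (grady f z') w by field.
  have -> : h * (h * muy / 2 * (h^-1 * (h^-1 * dot w w))) = muy / 2 * dot w w
    by field.
  have -> : h * ((f z' - f zs) / h) = f z' - f zs by field.
  lra.
- have := gap_increment cvxf cncf muy0 muxy z z'; rewrite dx dy => H.
  rewrite -(ler_pM2l h0) -mulrBl mulrCA mulfV// mulr1.
  move: (grady f zt + v1) H => q.
  by rewrite !(dotNl, dotNr, dotZl, dotZr); lra.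
Qed.

Lemma pce_potential_step s :
  (1 + D * (M + D) / (5 * M)) *
    pce_potential (pce_step f h alpha (h * mux / 8) s) <= pce_potential s.
Proof.
case: s => x y v; apply: (@potential_descent (x, y)); reflexivity.
Qed.

Let D30 : D <= 1 / 30.
Proof.
rewrite -(@ler_pXn2r _ 2) ?nnegrE ?divr_ge0 ?(ltW D0)//.
apply: (le_trans D2).
have a1 : h * muy <= 2 / 15.
  by apply: le_trans hL; rewrite ler_pM2l// (le_trans muxy).
have a2 : h * mux <= 2 / 15 by apply: le_trans hL; rewrite ler_pM2l.
have a0 : 0 <= h * muy by rewrite mulr_ge0 ?ltW.
have a3 : (h * mux) * (h * muy) <= 2 / 15 * (2 / 15).
  by apply: ler_pM => //; rewrite mulr_ge0 ?ltW.
by lra.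
Qed.

(** The gap term costs at most 31/96 |gx|^2 out of 1/2 |gx|^2, leaving more than 1/6; the cross term
    with Y costs |v|^2 / 2 out of 2 |v|^2. *)
Lemma pce_potential_lower s :
  muy ^+ 2 / 6 * sqdist (pce_point s) zs <= pce_potential s.
Proof.
have := dist_le_grad_sqr lipf cvxf cncf muy0 muxy muxL (pce_point s) sad.
have := gap_le_gradx cvxf muy0 muxy (pce_point s) sad.
rewrite /pce_potential /potential.
move: (sqdist _ _) (h^-1 *: _) (gradx _ _) (grady _ _) (pce_v s) (f _ - f zs).
move=> d w gx g v phi H1 H2.
have -> : 5 * M * (phi / h) = 5 / 16 * (1 + D) * (2 * mux * phi).
  by rewrite ME; field; rewrite gt_eqF.
have D10 : 0 <= 5 / 16 * (1 + D) by rewrite mulr_ge0// addr_ge0// ltW.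
have a1 := ler_wpM2l D10 H1.
have a2 := ler_wpM2r (dot_ge0 gx) D30.
have y1 := dot_young (- D) w v.
have y2 := dot_young (- (1 / 2)) g v.
move: a1 a2 y1 y2 (dot_ge0 gx) (dot_ge0 g) (dot_ge0 v).
by rewrite !dotE (dotC w v) (dotC v g); lra.
Qed.

(** Serves the initial state, where v = 0 removes the cross term. The negative part of the gap is
    controlled by concavity and the Lipschitz bound. *)
Lemma pce_potential_upper s : pce_v s = 0 ->
  pce_potential s <= 2 * L ^+ 2 * sqdist (pce_point s) zs.
Proof.
case: s => x y v /= ->; rewrite /pce_potential /pce_point /=.
have := grad_sqr_le_dist lipf cvxf cncf muy0 muxy muxL (x, y) sad.
have := grady_le_gap cncf (x, y) sad.
have := sqdistE (x, y) zs => /=.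
have := sqdist_ge0 (x, y) zs.
rewrite /potential addr0.
move: (f _ - f zs) (gradx _ _) (grady _ _) (sqdist _ _) => phi gx g d.
move: (x - zs.1) (y - zs.2) => x' y' d0 dE.
have -> : dot 0 (h^-1 *: y') = 0 by rewrite -(scale0r 0) dotZl mul0r.
rewrite dot0 dotZl dotZr => H1 H2.
have -> : 5 * M * (phi / h) = 5 / 8 * mux * (1 + D) * phi.
  by rewrite ME; field; rewrite gt_eqF.
have xx := dot_ge0 x'; have yy := dot_ge0 y'; have gg := dot_ge0 g.
have ggx := dot_ge0 gx.
have b1 : - L * dot g y' <= L ^+ 2 * d.
  have := dot_young (- L) y' g; rewrite (dotC y').
  have := mulr_ge0 (sqr_ge0 L) xx; rewrite dE in H2 *; lra.
have b2 : - phi <= L * d.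
  have b3 : - dot g y' <= L * d by rewrite -(ler_pM2l L0); lra.
  have := mulr_ge0 (ltW muy0) yy; lra.
have b4 : 5 / 8 * mux * (1 + D) <= 31 / 48 * L.
  have c1 : mux * (1 + D) <= L * (31 / 30).
    by apply: ler_pM; [exact: ltW|rewrite addr_ge0// ltW| |move: D30; lra].
  lra.
have b5 : 5 / 8 * mux * (1 + D) * - phi <= 31 / 48 * L * (L * d).
  have c0 : 0 <= 5 / 8 * mux * (1 + D).
    by rewrite !mulr_ge0 ?addr_ge0 // ltW.
  apply: (le_trans (ler_wpM2l c0 b2)).
  by apply: ler_wpM2r b4; rewrite mulr_ge0// ltW.
have b6 : D ^+ 2 / 2 * (h^-1 * (h^-1 * dot y' y')) <= L ^+ 2 / 32 * d.
  have -> : D ^+ 2 / 2 * (h^-1 * (h^-1 * dot y' y'))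
      = (D ^+ 2 / 2 / h ^+ 2) * dot y' y' by field; rewrite gt_eqF.
  apply: ler_pM => //; last by rewrite dE lerDr.
    by rewrite !divr_ge0 ?sqr_ge0.
  rewrite ler_pdivrMr ?exprn_gt0//.
  have c2 : mux * muy <= L * L.
    by rewrite ler_pM ?(ltW mux0) ?(ltW muy0)// (le_trans muxy).
  have := ler_wpM2l (sqr_ge0 h) c2; move: D2; lra.
lra.
Qed.

Lemma pce_dist_contraction z0 T :
  (1 + D / 5) ^+ T * (muy ^+ 2 * sqdist (pce_point
     (pce_iter f h alpha (h * mux / 8) z0 T)) zs)
  <= 12 * L ^+ 2 * sqdist z0 zs.
Proof.
have M0 : 0 < M by rewrite ME !mulr_gt0// addr_gt0.
have H : (1 + D / 5) ^+ T
      * pce_potential (pce_iter f h alpha (h * mux / 8) z0 T)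
    <= pce_potential (PceState z0.1 z0.2 0).
  elim: T => [|T IH]; first by rewrite expr0 mul1r.
  apply: le_trans IH; rewrite exprSr -mulrA ler_wpM2l//.
    by rewrite exprn_ge0// addr_ge0// divr_ge0// ltW.
  apply: le_trans (pce_potential_step _); apply: ler_wpM2r.
    apply: le_trans (pce_potential_lower _).
    by rewrite mulr_ge0 ?sqdist_ge0// divr_ge0 ?sqr_ge0.
  (* D (M + D) / (5 M) >= D / 5 because D is positive. *)
  rewrite lerD2l ler_pdivlMr ?mulr_gt0//.
  have -> : D / 5 * (5 * M) = D * M by field.
  by rewrite ler_wpM2l ?lerDl ?(ltW D0).
have U := @pce_potential_upper (PceState z0.1 z0.2 0) erefl.
have W := pce_potential_lower (pce_iter f h alpha (h * mux / 8) z0 T).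
rewrite /pce_point -surjective_pairing /= -/(pce_point _) in U.
have p0 : 0 <= (1 + D / 5) ^+ T.
  by rewrite exprn_ge0// addr_ge0// divr_ge0// ltW.
have := ler_wpM2l p0 W; move: U H; lra.
Qed.

End Descent.

(** * From the contraction factor to an iteration count *)

(** Inverts exp(-u/2) >= 1 - u/2, using (1 + u)(1 - u/2) >= 1 on [0, 1]. *)
Lemma expR_half_le (R : realType) (u : R) : 0 <= u -> u <= 1 ->
  expR (u / 2) <= 1 + u.
Proof.
move=> u0 u1; have E : 0 < expR (u / 2) by exact: expR_gt0.
have := expR_ge1Dx (- (u / 2)); rewrite expRN => H.
rewrite -(ler_pM2r (_ : 0 < (expR (u / 2))^-1)) ?invr_gt0//.
rewrite mulfV ?gt_eqF//; apply: le_trans (ler_wpM2l _ H); last by lra.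
have : u * u <= u by rewrite ler_piMr.
lra.
Qed.

Lemma ln2_ge_half (R : realType) : 1 / 2 <= ln (2 : R).
Proof.
rewrite -ler_expR lnK ?posrE//.
have := @expR_half_le R 1 ler01 (lexx _); lra.
Qed.

Lemma geometric_decay (R : realType) (c kx ky eps u : R) (T : nat) :
  0 < c -> c <= 2 / 15 -> 1 <= kx -> 1 <= ky -> 0 < eps -> eps < 1 ->
  c / (40 * Num.sqrt (kx * ky)) <= u ->
  320 / c * Num.sqrt (kx * ky) * ln (2 * kx * ky / eps) <= T%:R ->
  12 * ky ^+ 2 <= eps * (1 + u) ^+ T.
Proof.
move=> c0 c1 kx1 ky1 e0 e1 hu hT.
have kk1 : 1 <= kx * ky by rewrite -[1]mulr1 ler_pM.
have S1 : 1 <= Num.sqrt (kx * ky) by rewrite -[1]sqrtr1 ler_sqrt//; lra.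
set S := Num.sqrt _ in hu hT S1 *; have S0 : 0 < S by lra.
pose w := kx * ky / eps.
have wE : 2 * kx * ky / eps = 2 * w by rewrite /w !mulrA.
have we : w * eps = kx * ky by rewrite divfK// gt_eqF.
have w1 : 1 <= w by rewrite ler_pdivlMr//; lra.
rewrite {}wE in hT.
set l := ln _ in hT.
have lE : expR l = 2 * w by rewrite lnK// posrE; lra.
pose u0 := c / (40 * S).
have u00 : 0 <= u0 by rewrite divr_ge0// ltW// mulr_gt0.
have u01 : u0 <= 1 by rewrite ler_pdivrMr ?mulr_gt0//; lra.
(* 320 = 4 * 2 * 40 makes T u0 / 2 at least 4 l. The fourth power suffices: eps w >= 1, w >= 1 and w
   >= ky give eps (2 w)^4 >= 16 ky^2. *)
have H : (2 * w) ^+ 4 <= (1 + u) ^+ T.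
  have A : expR (u0 / 2) ^+ T <= (1 + u) ^+ T.
    have u0u : u0 <= u by [].
    have u1 : 0 <= 1 + u by lra.
    rewrite lerXn2r ?nnegrE ?expR_ge0//.
    by apply: le_trans (expR_half_le u00 u01) _; rewrite lerD2l.
  apply: le_trans A; rewrite -lE -!expRM_natl ler_expR.
  have -> : 4 * l = 320 / c * S * l * (u0 / 2).
    by rewrite /u0; field; rewrite !gt_eqF.
  by rewrite ler_wpM2r// divr_ge0.
apply: le_trans (ler_wpM2l (ltW e0) H).
have kw : ky <= w.
  rewrite ler_pdivlMr//; apply: (@le_trans _ _ ky).
    by rewrite ler_piMr//; lra.
  by rewrite ler_peMl//; lra.
have ew1 : 1 <= eps * w by rewrite mulrC we.
have -> : eps * (2 * w) ^+ 4 = 16 * (eps * w) * w * w ^+ 2 by ring.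
have k2 : ky ^+ 2 <= w ^+ 2 by rewrite lerXn2r ?nnegrE//; lra.
have : 1 * 1 * ky ^+ 2 <= eps * w * w * w ^+ 2.
  by apply: ler_pM => //; rewrite ?sqr_ge0//; apply: ler_pM.
have := sqr_ge0 ky; lra.
Qed.

(** * Query count and complexity bound *)

Lemma size_pce_queries (R : realType) n p (f : 'rV[R]_n * 'rV[R]_p -> R)
    h alpha rho z0 T :
  size (pce_queries f h alpha rho z0 T) = (2 * T).+1.
Proof.
rewrite /= -[in RHS](size_iota 0 T); congr _.+1.
by elim: (iota 0 T) => //= t r ->; rewrite mulnS.
Qed.

Lemma pce_dist_le (R : realType) (c : R) n p
    (f : 'rV[R]_n * 'rV[R]_p -> R) (L mux muy h alpha eps : R) zs z0 T :
  0 < c -> c <= 2 / 15 ->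
  lipschitz_grad f L -> strongly_convex_x f mux -> strongly_concave_y f muy ->
  mux <= L -> muy <= mux -> 0 < muy -> saddle_point f zs ->
  c / L <= h -> h <= 2 / (15 * L) ->
  4 / (4 + h * Num.sqrt (mux * muy)) <= alpha ->
  alpha <= 8 / (8 + h * Num.sqrt (mux * muy)) ->
  0 < eps -> eps < 1 ->
  320 / c * Num.sqrt (L / mux * (L / muy))
    * ln (2 * (L / mux) * (L / muy) / eps)
    <= T%:R ->
  sqdist (pce_point (pce_iter f h alpha (h * mux / 8) z0 T)) zs
    <= eps * sqdist z0 zs.
Proof.
move=> c0 c1 lipf cvxf cncf muxL muxy muy0 sad hc hL al au e0 e1 hT.
have mux0 : 0 < mux by lra.
have L0 : 0 < L by lra.
have h0 : 0 < h by apply: lt_le_trans hc; rewrite divr_gt0.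
have hL' : h * L <= 2 / 15.
  by rewrite -ler_pdivlMr//; apply: (le_trans hL); rewrite invfM mulrA.
set s := Num.sqrt (mux * muy) in al au.
have s0 : 0 < s by rewrite sqrtr_gt0 mulr_gt0.
have s2 : s ^+ 2 = mux * muy by rewrite sqr_sqrtr// mulr_ge0 ?ltW.
have hs : 0 < h * s by rewrite mulr_gt0.
have a0 : 0 < alpha by apply: lt_le_trans al; rewrite divr_gt0//; lra.
(* The range of alpha says exactly h s / 8 <= D <= h s / 4: the upper end gives the bound on D^2,
   the lower end the rate. *)
pose D := alpha^-1 - 1.
have DE : 1 + D = alpha^-1 by rewrite /D addrC subrK.
have Dl : h * s / 8 <= D.
  have : (8 / (8 + h * s))^-1 <= alpha^-1.
    by rewrite lef_pV2// posrE divr_gt0//; lra.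
  by rewrite invf_div -DE; lra.
have Du : D <= h * s / 4.
  have : alpha^-1 <= (4 / (4 + h * s))^-1.
    by rewrite lef_pV2// posrE divr_gt0//; lra.
  by rewrite invf_div -DE; lra.
have D0 : 0 < D by lra.
have D2 : D ^+ 2 <= (h * mux) * (h * muy) / 16.
  have -> : (h * mux) * (h * muy) / 16 = (h * s / 4) ^+ 2.
    by rewrite !exprMn s2; field.
  by rewrite lerXn2r// nnegrE; lra.
have ctr := pce_dist_contraction lipf cvxf cncf muy0 muxy muxL sad h0 hL' a0
  DE D0 (erefl _) D2 z0 T.
have SE : Num.sqrt (L / mux * (L / muy)) = L / s.
  have -> : L / mux * (L / muy) = (L / s) ^+ 2.
    by rewrite expr_div_n s2; field; rewrite !gt_eqF.
  by rewrite sqrtr_sqr ger0_norm// divr_ge0// ltW.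
have rate : c / (40 * Num.sqrt (L / mux * (L / muy))) <= D / 5.
  rewrite SE.
  have -> : c / (40 * (L / s)) = c / L * s / 40 by field; rewrite !gt_eqF.
  have := ler_wpM2r (ltW s0) hc; lra.
have kx1 : 1 <= L / mux by rewrite ler_pdivlMr// mul1r.
have ky1 : 1 <= L / muy by rewrite ler_pdivlMr// mul1r; lra.
have dec := geometric_decay c0 c1 kx1 ky1 e0 e1 rate hT.
have muy2 : 0 < muy ^+ 2 by rewrite exprn_gt0.
have dec' : 12 * L ^+ 2 <= eps * (1 + D / 5) ^+ T * muy ^+ 2.
  by rewrite -ler_pdivrMr// -mulrA -expr_div_n.
have P0 : 0 < (1 + D / 5) ^+ T by rewrite exprn_gt0//; lra.
rewrite -(ler_pM2l muy2) -(ler_pM2l P0); apply: (le_trans ctr).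
have := ler_wpM2r (sqdist_ge0 z0 zs) dec'; lra.
Qed.

Theorem mainTheorem2 :
  forall (R : realType) (c : R), 0 < c -> c <= 2 / 15 ->
  exists C K : R, 0 < C /\ 0 < K /\
  forall (n p : nat) (f : 'rV[R]_n * 'rV[R]_p -> R) (L mux muy : R),
    continuously_differentiable f ->
    lipschitz_grad f L ->
    strongly_convex_x f mux ->
    strongly_concave_y f muy ->
    mux <= L -> muy <= mux -> 0 < muy ->
  forall zs : 'rV[R]_n * 'rV[R]_p, saddle_point f zs ->
  forall h rho alpha : R,
    c / L <= h -> h <= 2 / (15 * L) ->
    rho = h * mux / 8 ->
    4 / (4 + h * Num.sqrt (mux * muy)) <= alpha ->
    alpha <= 8 / (8 + h * Num.sqrt (mux * muy)) ->
  forall z0 : 'rV[R]_n * 'rV[R]_p,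
  let kx := L / mux in
  let ky := L / muy in
  let D := fun t : nat => sqdist (pce_point (pce_iter f h alpha rho z0 t)) zs in
  forall eps : R, 0 < eps -> eps < 1 ->
    (forall T : nat,
       C * Num.sqrt (kx * ky) * ln (2 * kx * ky / eps) <= T%:R ->
       D T <= eps * D 0%N) /\
    (exists T : nat,
       D T <= eps * D 0%N /\
       (size (pce_queries f h alpha rho z0 T))%:R
         <= K * (Num.sqrt (kx * ky) * ln (2 * kx * ky / eps))).
Proof.
(* With x the iteration threshold, the queries number at most 2 x + 3; 640 / c accounts for 2 x, and
   6 for the 3, as sqrt(kx ky) times the logarithm is at least 1/2. *)
move=> R c c0 c1; exists (320 / c), (640 / c + 6).
have C0 : 0 < 320 / c by apply: divr_gt0; [lra|exact: c0].
split; first exact: C0.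
split; first lra.
move=> n p f L mux muy _ lipf cvxf cncf muxL muxy muy0 zs sad h rho alpha.
move=> hc hL -> al au z0 kx ky D eps e0 e1.
have main T : 320 / c * Num.sqrt (kx * ky) * ln (2 * kx * ky / eps) <= T%:R ->
    D T <= eps * D 0%N.
  move=> hT; have := pce_dist_le z0 c0 c1 lipf cvxf cncf muxL muxy muy0 sad hc
    hL al au e0 e1 hT.
  by rewrite /D /pce_point /= -surjective_pairing.
split=> //.
have mux0 : 0 < mux by lra.
have L0 : 0 < L by lra.
have kx1 : 1 <= kx by rewrite /kx ler_pdivlMr// mul1r.
have ky1 : 1 <= ky by rewrite /ky ler_pdivlMr// mul1r; lra.
have kk1 : 1 <= kx * ky by rewrite -[1]mulr1 ler_pM.
have S1 : 1 <= Num.sqrt (kx * ky) by rewrite -[1]sqrtr1 ler_sqrt//; lra.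
have l1 : 1 / 2 <= ln (2 * kx * ky / eps).
  apply: le_trans (ln2_ge_half R) _; rewrite ler_ln ?posrE//.
    have w1 : 1 <= kx * ky / eps by rewrite ler_pdivlMr//; lra.
    lra.
  by rewrite divr_gt0// -mulrA mulr_gt0//; lra.
move: main; set x := 320 / c * _ * _ => main.
(* The successor of the integer part is above x and at most x + 1. *)
exists (Num.truncn x).+1; split; first exact: main (ltW (truncnS_gt x)).
have Sl : 1 / 2 <= Num.sqrt (kx * ky) * ln (2 * kx * ky / eps).
  by rewrite -[1 / 2]mul1r ler_pM//; lra.
have x0 : 0 <= x by rewrite /x -mulrA mulr_ge0 ?ltW//; lra.
have /andP[tx _] := truncn_itv x0.
rewrite size_pce_queries -natr1 natrM -natr1.
have : (640 / c) * (Num.sqrt (kx * ky) * ln (2 * kx * ky / eps)) = 2 * x.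
  by rewrite /x; field; rewrite gt_eqF.
lra.
Qed.
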